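(* Let $(X,X^+)$ be an ordered Banach space with a generating and normal cone $X^+$. Consider the system $x(k+1)\le A(x(k))+u(k)$, $k\in\mathbb{Z}_+$, and assume that the operator $A:X^+\to X^+$ is monotone and satisfies: (i) $A$ is homogeneous of degree one, i.e. $A(rx)=rA(x)$ for all $x\in X^+$ and $r\ge0$. (ii) $A$ is subadditive, i.e. $A(x+y)\le A(x)+A(y)$ for all $x,y\in X^+$. (iii) $C:=\sup_{x\in X^+,\ \|x\|_X=1}\|A(x)\|_X<\infty$. Then $A$ is globally Lipschitz continuous and the following statements are equivalent: (a) The system is eISS. (b) It holds that $r(A):=\lim_{n\to\infty}\sup_{x\in X^+,\ \|x\|_X=1}\|A^n(x)\|_X^{1/n}<1$. (c) There are a globally Lipschitz function $V:X^+\to\mathbb{R}_+$ and constants $L_1,L_2,\psi>0$, $\eta>1$, such that $L_1\|x\|_X\le V(x)\le L_2\|x\|_X$ for all $x\in X^+$, and for any $u\in\ell_\infty(\mathbb{Z}_+,X^+)$ and any solution $x(\cdot)$ of the system it holds that $V(x(k+1))\le\eta^{-1}V(x(k))+\psi\|u\|_\infty$ for all $k\ge0$.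
   Context: An ordered Banach space $(X,X^+)$ is a real Banach space $X$ with a closed subset $X^+$ (cone) satisfying $X^+\cap(-X^+)=\{0\}$, $\mathbb{R}_+\cdot X^+\subset X^+$, $X^++X^+\subset X^+$; $x\le y$ iff $y-x\in X^+$. The cone is generating if $X^+-X^+=X$, and normal if there is $\delta>0$ with $\|x_1\|_X\le\delta\|x_2\|_X$ whenever $0\le x_1\le x_2$. $A$ is monotone if $x\le y\Rightarrow A(x)\le A(y)$ for $x,y\in X^+$. $\mathcal{K}_\infty$: continuous, strictly increasing, unbounded $\gamma:\mathbb{R}_+\to\mathbb{R}_+$ with $\gamma(0)=0$. $\ell_\infty(\mathbb{Z}_+,X^+)$ is the set of sequences $u$ in $X^+$ with $\|u\|_\infty:=\sup_k\|u(k)\|_X<\infty$. A solution for input $u$ is a map $x:\mathbb{Z}_+\to X^+$ satisfying the inequality for all $k\in\mathbb{Z}_+$. The system is exponentially input-to-state stable (eISS) if there are $M\ge1$, $a\in(0,1)$, $\gamma\in\mathcal{K}_\infty$ such that for every $u\in\ell_\infty(\mathbb{Z}_+,X^+)$ and any solution $x(\cdot)$: $\|x(k)\|_X\le M\|x(0)\|_Xa^k+\gamma(\|u\|_\infty)$ for all $k\in\mathbb{Z}_+$. *)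

(* Defs.v *)
From HB Require Import structures.
From mathcomp Require Import all_boot all_order all_algebra.
From mathcomp Require Import all_classical all_reals all_analysis.

Set Implicit Arguments.
Unset Strict Implicit.
Unset Printing Implicit Defensive.

Import Order.TTheory GRing.Theory Num.Theory.
Import numFieldNormedType.Exports.

Local Open Scope classical_set_scope.
Local Open Scope ring_scope.

(* An operator X^+ -> X^+ or a function X^+ -> R_+ is represented by a total
   function on X; all conditions, and all definitions below, depend only on
   its values on the cone K = X^+. *)

Record is_cone (R : realType) (X : normedModType R) (K : set X) : Prop :=
  IsCone {
    cone_closed : closed K;
    cone_pointed : K `&` [set - x | x in K] = [set 0];
    cone_scale : forall (r : R) (x : X), 0 <= r -> K x -> K (r *: x);
    cone_add : forall x y : X, K x -> K y -> K (x + y) }.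

Definition cone_le (R : realType) (X : normedModType R) (K : set X)
  (x y : X) : Prop := K (y - x).

Definition generating (R : realType) (X : normedModType R) (K : set X)
  : Prop := [set x - y | x in K & y in K] = setT.

Definition normal_cone (R : realType) (X : normedModType R) (K : set X)
  : Prop :=
  exists2 delta : R, 0 < delta &
    forall x1 x2 : X, cone_le K 0 x1 -> cone_le K x1 x2 ->
      `|x1| <= delta * `|x2|.

Definition monotone_on (R : realType) (X : normedModType R) (K : set X)
  (A : X -> X) : Prop :=
  forall x y : X, K x -> K y -> cone_le K x y -> cone_le K (A x) (A y).

Definition cone_sphere (R : realType) (X : normedModType R) (K : set X)
  : set X := [set x | K x /\ `|x| = 1].

Definition sup_norm (R : realType) (X : normedModType R) (u : nat -> X)
  : \bar R := ereal_sup [set `|u k|%:E | k in [set: nat]].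

Definition ell_infty (R : realType) (X : normedModType R) (K : set X)
  : set (nat -> X) :=
  [set u | (forall k, K (u k)) /\ (sup_norm u < +oo)%E].

Definition solution (R : realType) (X : normedModType R) (K : set X)
  (A : X -> X) (u x : nat -> X) : Prop :=
  (forall k, K (x k)) /\ (forall k, cone_le K (x k.+1) (A (x k) + u k)).

(* gamma is nonnegative on `[0, +oo[ by the first two fields. *)
Record class_Kinfty (R : realType) (gamma : R -> R) : Prop := ClassKinfty {
  Kinfty0 : gamma 0 = 0;
  Kinfty_incr : forall s t : R, 0 <= s -> s < t -> gamma s < gamma t;
  Kinfty_cont : {within [set s : R | 0 <= s], continuous gamma};
  Kinfty_unbounded : forall c : R, exists2 s : R, 0 <= s & c < gamma s }.

Definition eISS (R : realType) (X : normedModType R) (K : set X)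
  (A : X -> X) : Prop :=
  exists (M a : R) (gamma : R -> R),
    [/\ 1 <= M, 0 < a < 1, class_Kinfty gamma &
      forall u x : nat -> X, ell_infty K u -> solution K A u x ->
        forall k : nat,
          `|x k| <= M * `|x 0%N| * a ^+ k + gamma (fine (sup_norm u))].

(* The real supremum is the genuine one when A is homogeneous of degree one
   and bounded on the sphere; for X = {0} the sphere is empty and sup set0 is
   0. The term n = 0 is irrelevant for the limit. *)
Definition sphere_root (R : realType) (X : normedModType R) (K : set X)
  (A : X -> X) (n : nat) : R :=
  sup [set `|iter n A x| `^ n%:R^-1 | x in cone_sphere K].

Definition cone_radius (R : realType) (X : normedModType R) (K : set X)
  (A : X -> X) : R := limn (sphere_root K A).

Definition eISS_Lyapunov (R : realType) (X : normedModType R) (K : set X)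
  (A : X -> X) (V : X -> R) : Prop :=
  [/\ forall x : X, K x -> 0 <= V x,
      [lipschitz V x | x in K] &
      exists L1 L2 psi eta : R,
        [/\ [/\ 0 < L1, 0 < L2, 0 < psi & 1 < eta],
            forall x : X, K x -> L1 * `|x| <= V x <= L2 * `|x| &
            forall u x : nat -> X, ell_infty K u -> solution K A u x ->
              forall k : nat,
                V (x k.+1) <= eta^-1 * V (x k) + psi * fine (sup_norm u)]].

(* Main.v *)
Require Import Defs.
From HB Require Import structures.
From mathcomp Require Import all_boot all_order all_algebra.
From mathcomp Require Import all_classical all_reals all_analysis.
From mathcomp Require Import ring lra.

Set Implicit Arguments.
Unset Strict Implicit.
Unset Printing Implicit Defensive.

Import Order.TTheory GRing.Theory Num.Theory.
Import numFieldNormedType.Exports.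

Local Open Scope classical_set_scope.
Local Open Scope ring_scope.

(** By the Baire category theorem a closed generating cone in a Banach space
    decomposes every x as y - z with |y|, |z| <= c |x|; hence x <= y + p for
    some p in the cone with |p| <= c |x - y|, and monotonicity, subadditivity
    and normality turn this into a Lipschitz bound.

    The input u = 0 makes eISS an exponential bound on |A^n x|, that is r(A) < 1.
    Conversely, if r(A) < 1, then |A^N x| <= c^N |x| on the cone for some N >= 1
    and c < 1.  The norm itself is not monotone, but
    p(x) = inf {|y| : x <= y} is monotone and subadditive, and by normality it
    is equivalent to the norm on the cone.  Therefore
    V(x) = \sum_(n < N) c^-n p(A^n x) is monotone and subadditive with
    V(A x) <= c V(x), and V(A x + u) <= c V(x) + V(u) gives the dissipation
    inequality.  Iterating that inequality yields eISS. *)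

(** * Bounded decomposition along a closed generating cone *)

Lemma cone0 (R : realType) (X : normedModType R) (K : set X) :
  is_cone K -> K 0.
Proof.
move=> hK; have: [set 0 : X] 0 by [].
by rewrite -(cone_pointed hK) => -[].
Qed.

(** The sets [D n] cover the space, so by Baire some closure of [D n] contains a ball around a point
    [x0]. As [D n] is symmetric and convex, the ball can be recentred at the origin, and scaling
    then reaches every [x]. Baire controls only the closure, hence the error [e]. *)
Lemma generating_approx (R : realType) (X : completeNormedModType R)
    (K : set X) : is_cone K -> generating K ->
  exists2 c : R, 0 <= c & forall (x : X) (e : R), 0 < e ->
    exists y z : X, [/\ K y, K z, `|y| <= c * `|x|, `|z| <= c * `|x| &
      `|x - (y - z)| < e].
Proof.
move=> hK hgen.
pose D (n : nat) : set X := [set x | exists y z : X,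
  [/\ K y, K z, `|y| <= n%:R, `|z| <= n%:R & x = y - z]].
have [n [U [[x0 Ux0] UD]]] : exists n (U : set X),
    (exists x, open_nbhs x U) /\ U `&` ~` closure (D n) = set0.
  apply: contrapT => /forallNP nD.
  have dD n : open (~` closure (D n)) /\ dense (~` closure (D n)).
    split; first exact/closed_openC/closed_closure.
    by apply: contrapT => /denseNE [U HU]; apply: (nD n); exists U.
  have [| |x [_ Dx]] := @Baire _ _ _ dD setT; first by exists 0.
    exact: openT.
  have [y Ky [z Kz yzx]] : [set x - y | x in K & y in K] x by rewrite hgen.
  have yge : 0 <= Num.max `|y| `|z| by rewrite le_max normr_ge0.
  apply: (Dx (Num.bound (Num.max `|y| `|z|)) I).
  apply: subset_closure; exists y, z; split=> //.
    by apply: le_trans (ltW (archi_boundP yge)); rewrite le_max lexx.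
  by apply: le_trans (ltW (archi_boundP yge)); rewrite le_max lexx orbT.
have [r /= r0 xrU] : nbhs_ball x0 U by apply/nbhs_ballP; exact: open_nbhs_nbhs.
have clD h : `|h| < r -> closure (D n) (x0 + h).
  move=> hr; apply: contrapT => nDh.
  have : (U `&` ~` closure (D n)) (x0 + h).
    split=> //; apply: xrU; rewrite -ball_normE /= opprD addrA subrr add0r.
    by rewrite normrN.
  by rewrite UD.
(* h is the midpoint of x0 + h and -(x0 - h). *)
have approx h e : `|h| < r -> 0 < e -> exists y z : X,
    [/\ K y, K z, `|y| <= n%:R, `|z| <= n%:R & `|h - (y - z)| < e].
  move=> hr e0.
  have [p [[y1 [z1 [Ky1 Kz1 yn1 zn1 ->]]]]] := clD _ hr _ (nbhsx_ballx _ _ e0).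
  rewrite -ball_normE /= => e1.
  have hr' : `|- h| < r by rewrite normrN.
  have [q [[y2 [z2 [Ky2 Kz2 yn2 zn2 ->]]]]] := clD _ hr' _ (nbhsx_ballx _ _ e0).
  rewrite -ball_normE /= => e2.
  have h0 : (0 : R) <= 2^-1 by rewrite invr_ge0.
  have half a b : `|a| <= n%:R -> `|b| <= n%:R ->
      `|2^-1 *: (a + b) : X| <= n%:R.
    move=> an bn; rewrite normrZ ger0_norm//.
    have := ler_normD a b; lra.
  exists (2^-1 *: (y1 + z2)), (2^-1 *: (z1 + y2)); split.
  - by apply: (cone_scale hK) => //; exact: (cone_add hK).
  - by apply: (cone_scale hK) => //; exact: (cone_add hK).
  - exact: half.
  - exact: half.
  have -> : h - (2^-1 *: (y1 + z2) - 2^-1 *: (z1 + y2)) =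
      2^-1 *: ((x0 + h - (y1 - z1)) - (x0 - h - (y2 - z2))).
    have -> : x0 + h - (y1 - z1) - (x0 - h - (y2 - z2)) =
        h + h - ((y1 + z2) - (z1 + y2)).
      rewrite !(opprD, opprK, addrA).
      by rewrite [LHS](ACl (1*5*2*6*3*8*4*7))%AC /= subrr add0r.
    rewrite -scalerBr [RHS]scalerBr; congr (_ - _).
    by rewrite -[h + h]mulr2n -(scaler_nat 2 h) scalerA mulVf ?scale1r// pnatr_eq0.
  rewrite normrZ ger0_norm//.
  have := ler_normB (x0 + h - (y1 - z1)) (x0 - h - (y2 - z2)); lra.
exists (n%:R * (2 / r)); first by rewrite mulr_ge0// divr_ge0// ltW.
move=> x e e0; have [->|x0'] := eqVneq x 0.
  exists 0, 0; rewrite !subrr normr0 mulr0; split=> //; exact: cone0.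
have nx : 0 < `|x| by rewrite normr_gt0.
(* Dividing by [t] brings [x] to norm [r / 2], inside the ball; the tolerance [e / t] becomes [e]
   when scaled back. *)
pose t := 2 / r * `|x|.
have t0 : 0 < t by rewrite mulr_gt0// divr_gt0.
have ht : `|t^-1 *: x| < r.
  rewrite normrZ ger0_norm ?invr_ge0 ?ltW// /t invfM mulrVK ?unitf_gt0//.
  by rewrite invf_div; lra.
have et : 0 < e / t by rewrite divr_gt0.
have [y [z [Ky Kz yn zn H]]] := approx _ _ ht et.
have scal a : `|a| <= n%:R -> `|t *: a| <= n%:R * (2 / r) * `|x|.
  by move=> an; rewrite normrZ gtr0_norm// -mulrA -/t mulrC ler_wpM2r// ltW.
exists (t *: y), (t *: z); split; [| |exact: scal|exact: scal|].
- by apply: (cone_scale hK); first exact: ltW.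
- by apply: (cone_scale hK); first exact: ltW.
have -> : x - (t *: y - t *: z) = t *: (t^-1 *: x - (y - z)).
  by rewrite scalerBr scalerA mulfV ?gt_eqF// scale1r scalerBr.
by rewrite normrZ gtr0_norm// mulrC -ltr_pdivlMr.
Qed.

(** The geometric majorant gives absolute convergence, hence convergence by completeness; the
    partial sums lie in the cone, and its closedness keeps the limit there. *)
Lemma cone_series (R : realType) (X : completeNormedModType R) (K : set X)
    (w : nat -> X) (a : R) : is_cone K -> (forall n, K (w n)) ->
  (forall n, `|w n| <= a * 2^-1 ^+ n) ->
  exists l : X, [/\ series w @ \oo --> l, K l & `|l| <= 2 * a].
Proof.
move=> hK Kw wa.
have Ks n : K (series w n).
  rewrite seriesEnat /=; elim: n => [|n IH].
    by rewrite big_nil; exact: cone0 hK.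
  by rewrite big_nat_recr//=; exact: (cone_add hK).
(* The subtracted term makes this the exact geometric partial sum, so that the induction closes. *)
have sa n : `|series w n| <= 2 * a - 2 * a * 2^-1 ^+ n.
  rewrite seriesEnat /=; elim: n => [|n IH].
    by rewrite big_nil normr0 expr0 mulr1 subrr.
  rewrite big_nat_recr//= exprS.
  by have := ler_normD (\sum_(0 <= i < n) w i) (w n); have := wa n; lra.
have a0 : 0 <= a by have := wa 0%N; rewrite expr0 mulr1; exact: le_trans.
have cw : cvgn (series w).
  apply: normed_cvg; apply: (@series_le_cvg _ _ (geometric a 2^-1)) => //=.
  - by move=> n; rewrite mulr_ge0// exprn_ge0// invr_ge0.
  - by apply: is_cvg_geometric_series; rewrite ger0_norm ?invr_ge0//; lra.
exists (limn (series w)); split => //.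
- apply: (@closed_cvg _ X \oo _ (series w) K (cone_closed hK) _ _ cw).
  by near=> n.
- rewrite -lim_norm//; apply: limr_le; first exact: is_cvg_norm.
  near=> n; apply: le_trans (sa n) _.
  have : 0 <= 2 * a * 2^-1 ^+ n by rewrite !mulr_ge0// exprn_ge0// invr_ge0.
  lra.
Unshelve. all: by end_near. Qed.

(* The approximation error is halved at each step, so that the corrections sum
   up to an exact decomposition. *)
Lemma generating_decomposition (R : realType) (X : completeNormedModType R)
    (K : set X) : is_cone K -> generating K ->
  exists2 c : R, 0 <= c & forall x : X, exists y z : X,
    [/\ K y, K z, x = y - z, `|y| <= c * `|x| & `|z| <= c * `|x|].
Proof.
move=> hK hgen; have [c c0 cP] := generating_approx hK hgen.
have /choice[f fP] (x : X) : exists p : X * X, [/\ K p.1, K p.2,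
    `|p.1| <= c * `|x|, `|p.2| <= c * `|x| &
    `|x - (p.1 - p.2)| <= 2^-1 * `|x|].
  have [->|x0] := eqVneq x 0.
    exists (0, 0); rewrite /= !subrr normr0 !mulr0.
    by split=> //; exact: cone0 hK.
  have ex : 0 < 2^-1 * `|x| by rewrite mulr_gt0 ?invr_gt0 ?normr_gt0.
  by have [y [z [? ? ? ? /ltW ?]]] := cP x _ ex; exists (y, z).
exists (2 * c) => [|x]; first exact: mulr_ge0.
(* [e n] is the remainder after [n] corrections. *)
pose e n := iter n (fun w => w - ((f w).1 - (f w).2)) x.
have en n : `|e n| <= `|x| * 2^-1 ^+ n.
  elim: n => [|n IH]; first by rewrite expr0 mulr1.
  rewrite exprS /e iterS; have [_ _ _ _] := fP (e n); rewrite -/(e n); lra.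
have geo (w : X) n : `|w| <= c * `|e n| -> `|w| <= c * `|x| * 2^-1 ^+ n.
  by move/le_trans; apply; rewrite -mulrA ler_wpM2l.
have [|n|y [cy Ky yc]] := @cone_series _ _ K (fun n => (f (e n)).1) (c * `|x|)
    hK.
- by move=> n; have [] := fP (e n).
- by apply: geo; have [] := fP (e n).
have [|n|z [cz Kz zc]] := @cone_series _ _ K (fun n => (f (e n)).2) (c * `|x|)
    hK.
- by move=> n; have [] := fP (e n).
- by apply: geo; have [] := fP (e n).
exists y, z; split=> //; rewrite -?mulrA//.
have ce : e @ \oo --> (0 : X).
  apply: norm_cvg0.
  apply: (@squeeze_cvgr _ _ _ _ (cst 0) (geometric `|x| 2^-1)).
  - by near=> n => /=; rewrite normr_ge0 en.
  - exact: cvg_cst.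
  - by apply: cvg_geometric; rewrite ger0_norm ?invr_ge0//; lra.
have cx : (x - e n) @[n --> \oo] --> x.
  by rewrite -[X in _ --> X]subr0; apply: cvgB => //; exact: cvg_cst.
(* By telescoping, [x - e n] is the difference of the partial sums of the two series, so its limit
   is also [y - z]. *)
have cyz : (x - e n) @[n --> \oo] --> y - z; last first.
  exact: (cvg_unique (@norm_hausdorff _ X) cx cyz).
apply: cvg_trans (cvgB cy cz); apply: near_eq_cvg; apply: nearW => n.
rewrite /= !fctE !seriesEnat /=; elim: n => [|n IH].
  by rewrite !big_nil /e /= !subrr.
rewrite !big_nat_recr//= opprD addrACA IH.
by rewrite opprB -addrA [- _ + _]addrC.
Unshelve. all: by end_near. Qed.

(** * Cone order and sublinear operators *)

Lemma cone_lexx (R : realType) (X : normedModType R) (K : set X) (x : X) :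
  is_cone K -> cone_le K x x.
Proof. by move=> hK; rewrite /cone_le subrr; exact: cone0. Qed.

Lemma cone_le_trans (R : realType) (X : normedModType R) (K : set X)
    (y x z : X) : is_cone K -> cone_le K x y -> cone_le K y z -> cone_le K x z.
Proof.
by move=> hK xy yz; rewrite /cone_le -(subrKA y z); exact: (cone_add hK).
Qed.

Lemma cone_leD (R : realType) (X : normedModType R) (K : set X)
    (x y x' y' : X) : is_cone K -> cone_le K x x' -> cone_le K y y' ->
  cone_le K (x + y) (x' + y').
Proof.
by move=> hK xx yy; rewrite /cone_le opprD addrACA; exact: (cone_add hK).
Qed.

Lemma cone_le_in (R : realType) (X : normedModType R) (K : set X) (x y : X) :
  is_cone K -> K x -> cone_le K x y -> K y.
Proof. by move=> hK Kx xy; rewrite -(subrK x y); exact: (cone_add hK). Qed.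

Record sublinear_on (R : realType) (X : normedModType R) (K : set X)
    (A : X -> X) : Prop := SublinearOn {
  sublinear_in : forall x, K x -> K (A x);
  sublinear_mono : monotone_on K A;
  sublinear_hom : forall (r : R) x, 0 <= r -> K x -> A (r *: x) = r *: A x;
  sublinear_sub : forall x y, K x -> K y -> cone_le K (A (x + y)) (A x + A y) }.

(** The properties must be propagated together: subadditivity of the next iterate applies the
    monotonicity of [A] to the subadditivity of the previous one. *)
Lemma sublinear_iter (R : realType) (X : normedModType R) (K : set X)
    (A : X -> X) (n : nat) : is_cone K ->
  sublinear_on K A -> sublinear_on K (iter n A).
Proof.
move=> hK hA; elim: n => [|n [iK imono ihom isub]].
  by split=> //= x y Kx Ky; exact: cone_lexx.
split=> [x Kx|x y Kx Ky xy|r x r0 Kx|x y Kx Ky]; rewrite !iterS.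
- exact/(sublinear_in hA)/iK.
- by apply: (sublinear_mono hA); [exact: iK|exact: iK|exact: imono].
- by rewrite ihom// (sublinear_hom hA)//; exact: iK.
- have KD : K (iter n A (x + y)) by apply/iK/(cone_add hK).
  have Kx' := iK _ Kx; have Ky' := iK _ Ky.
  apply: (cone_le_trans (y := A (iter n A x + iter n A y))) => //.
    apply: (sublinear_mono hA) => //; first exact: (cone_add hK).
    exact: isub.
  exact: (sublinear_sub hA).
Qed.

Lemma sublinear0 (R : realType) (X : normedModType R) (K : set X)
    (A : X -> X) : is_cone K -> sublinear_on K A -> A 0 = 0.
Proof.
by move=> hK hA; rewrite -(scale0r 0) (sublinear_hom hA) ?scale0r//; apply: cone0.
Qed.

Lemma sublinear_norm_le (R : realType) (X : normedModType R) (K : set X)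
    (A : X -> X) (c : R) : is_cone K -> sublinear_on K A ->
  (forall x, cone_sphere K x -> `|A x| <= c) ->
  forall x, K x -> `|A x| <= c * `|x|.
Proof.
move=> hK hA cP x Kx; have [->|x0] := eqVneq x 0.
  by rewrite (sublinear0 hK hA) normr0 mulr0.
have nx : 0 < `|x| by rewrite normr_gt0.
have -> : x = `|x| *: (`|x|^-1 *: x) by rewrite scalerA mulfV ?gt_eqF// scale1r.
have Kx' : K (`|x|^-1 *: x) by apply: (cone_scale hK); rewrite ?invr_ge0.
have nx' : `| `|x|^-1 *: x| = 1.
  by rewrite normrZ ger0_norm ?invr_ge0// mulVf ?gt_eqF.
rewrite (sublinear_hom hA)// normrZ [in leRHS]normrZ nx' mulr1 mulrC ler_wpM2r//.
exact: cP.
Qed.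

Lemma sublinear_bounded (R : realType) (X : normedModType R) (K : set X)
    (A : X -> X) : is_cone K -> sublinear_on K A ->
  (ereal_sup [set `|A x|%:E | x in cone_sphere K] < +oo)%E ->
  exists2 C : R, 1 <= C & forall x, K x -> `|A x| <= C * `|x|.
Proof.
move=> hK hA; set s := ereal_sup _ => soo.
(* On an empty sphere the supremum is [-oo], whose [fine] is 0; the maximum with 1 gives a usable
   constant in every case. *)
exists (Num.max 1 (fine s)); first by rewrite le_max lexx.
apply: sublinear_norm_le => // x Sx; rewrite le_max; apply/orP; right.
have As : (`|A x|%:E <= s)%E by apply: ereal_sup_ubound; exists x.
by move: soo As; case: s => [r _||]; rewrite ?lee_fin.
Qed.

(** * Lipschitz continuity on the cone *)

(** Dropping the negative part of a decomposition [x - y = p - q] leaves the majorant [y + p] of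
    [x]. *)
Lemma generating_majorant (R : realType) (X : completeNormedModType R)
    (K : set X) : is_cone K -> generating K ->
  exists2 c : R, 0 <= c &
    forall x y : X, exists p, [/\ K p, cone_le K x (y + p) & `|p| <= c * `|x - y|].
Proof.
move=> hK hgen; have [c c0 cP] := generating_decomposition hK hgen.
exists c => // x y; have [p [q [Kp Kq xypq pc _]]] := cP (x - y).
exists p; split=> //; rewrite /cone_le.
by rewrite addrAC -opprB xypq opprB subrK.
Qed.

Lemma cone_lipschitz (R : realType) (X W : normedModType R) (K : set X)
    (f : X -> W) (k : R) : is_cone K ->
  (forall x y, K x -> K y -> `|f x - f y| <= k * `|x - y|) ->
  [lipschitz f x | x in K].
Proof.
move=> hK hf; have FF : ProperFilter (globally (K `*` K)).
  by apply: (@globally_properfilter _ _ (0, 0)); split; exact: cone0.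
by apply: klipschitzW => -[x y] [/= Kx Ky]; exact: hf.
Qed.

Lemma normal_lipschitz (R : realType) (X : completeNormedModType R)
    (K : set X) (A : X -> X) (C : R) : is_cone K -> generating K ->
  normal_cone K -> sublinear_on K A -> 0 <= C ->
  (forall x, K x -> `|A x| <= C * `|x|) -> [lipschitz A x | x in K].
Proof.
move=> hK hgen [d d0 hd] hA C0 hC.
have [c c0 cP] := generating_majorant hK hgen.
(* [A p] and [A q] have norm at most [C * c * |x - y|]. Normality contributes [d] times both, and
   removing the shift by [A q] contributes one more. *)
apply: (cone_lipschitz (k := (1 + 2 * d) * (C * c))) => // x y Kx Ky.
have le v w r : K v -> K w -> K r -> cone_le K v (w + r) ->
    cone_le K (A v) (A w + A r).
  move=> Kv Kw Kr vwr; apply: (cone_le_trans (y := A (w + r))) => //.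
    by apply: (sublinear_mono hA) => //; exact: (cone_add hK).
  exact: (sublinear_sub hA).
have small (r v w : X) : K r -> `|r| <= c * `|v - w| -> `|A r| <= C * c * `|v - w|.
  by move=> Kr rc; apply: le_trans (hC _ Kr) _; rewrite -mulrA ler_wpM2l.
have [p [Kp xyp pc]] := cP x y; have [q [Kq yxq qc]] := cP y x.
have Ap := small _ _ _ Kp pc.
have Aq := small _ _ _ Kq qc; rewrite (distrC y) in Aq.
have xle := le _ _ _ Kx Ky Kp xyp; have yle := le _ _ _ Ky Kx Kq yxq.
(* Normality needs a nonnegative vector: the shift by [A q] places [A x - A y] between 0 and
   [A p + A q]. *)
have : `|A x + A q - A y| <= d * `|A p + A q|.
  apply: hd; first by rewrite /cone_le subr0.
  rewrite /cone_le in xle *.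
  have -> : A p + A q - (A x + A q - A y) = A y + A p - A x.
    by rewrite !(opprD, opprK, addrA) [LHS](ACl (2*4*5*1*3))%AC /= subrr add0r.
  by [].
have : `|A x - A y| <= `|A x + A q - A y| + `|A q|.
  by rewrite -[X in `|X| <= _](addrK (A q)) (addrAC (A x)) ler_normB.
have dle : d * `|A p + A q| <= d * (2 * (C * c * `|x - y|)).
  by apply: ler_wpM2l; [exact: ltW|have := ler_normD (A p) (A q); lra].
lra.
Qed.

(** * A monotone substitute for the norm *)

(** This is the canonical half-norm of the ordered space, the distance from [-x] to the cone. It
    vanishes on [-K], so it is not a norm on the whole space. *)
Definition monotone_norm (R : realType) (X : normedModType R) (K : set X)
  (x : X) : R := inf [set `|y| | y in cone_le K x].

Lemma monotone_norm_lbound (R : realType) (X : normedModType R) (K : set X)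
    (x : X) : has_lbound [set `|y| | y in cone_le K x].
Proof. by exists 0 => _ [y _ <-]. Qed.

Lemma monotone_norm_ge (R : realType) (X : normedModType R) (K : set X)
    (x : X) (c : R) : is_cone K -> (forall y, cone_le K x y -> c <= `|y|) ->
  c <= monotone_norm K x.
Proof.
move=> hK cP; apply: lb_le_inf; first by exists `|x|, x => //; exact: cone_lexx.
by move=> _ [y xy <-]; exact: cP.
Qed.

Lemma monotone_norm_le (R : realType) (X : normedModType R) (K : set X)
    (x y : X) : cone_le K x y -> monotone_norm K x <= `|y|.
Proof. by move=> xy; apply: ge_inf; [exact: monotone_norm_lbound|exists y]. Qed.

Lemma monotone_normD (R : realType) (X : normedModType R) (K : set X)
    (x y : X) : is_cone K ->
  monotone_norm K (x + y) <= monotone_norm K x + monotone_norm K y.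
Proof.
move=> hK; rewrite -lerBlDr; apply: monotone_norm_ge => // a xa.
rewrite lerBlDl -lerBlDr; apply: monotone_norm_ge => // b yb.
rewrite lerBlDr; apply: le_trans (ler_normD b a).
by apply: monotone_norm_le; rewrite addrC; exact: cone_leD.
Qed.

Lemma monotone_norm_mono (R : realType) (X : normedModType R) (K : set X)
    (x y : X) : is_cone K -> cone_le K x y ->
  monotone_norm K x <= monotone_norm K y.
Proof.
move=> hK xy; apply: monotone_norm_ge => // z yz; apply: monotone_norm_le.
exact: cone_le_trans xy yz.
Qed.

(** [A] sends majorants of [x] to majorants of [A x], so the constant [c] carries over unchanged,
    without a factor from normality. *)
Lemma monotone_norm_sublinear (R : realType) (X : normedModType R) (K : set X)
    (A : X -> X) (c : R) (x : X) : is_cone K -> sublinear_on K A -> 0 < c ->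
  (forall y, K y -> `|A y| <= c * `|y|) -> K x ->
  monotone_norm K (A x) <= c * monotone_norm K x.
Proof.
move=> hK hA c0 cP Kx; rewrite mulrC -ler_pdivrMr//.
apply: monotone_norm_ge => // y xy; rewrite ler_pdivrMr// mulrC.
have Ky := cone_le_in hK Kx xy; apply: le_trans (cP _ Ky).
by apply: monotone_norm_le; exact: (sublinear_mono hA).
Qed.

(** * The Lyapunov function *)

Definition truncated_lyapunov (R : realType) (X : normedModType R) (K : set X)
  (A : X -> X) (eta : R) (N : nat) (x : X) : R :=
  \sum_(0 <= n < N) eta ^+ n * monotone_norm K (iter n A x).

Lemma truncated_lyapunov_mono (R : realType) (X : normedModType R) (K : set X)
    (A : X -> X) (eta : R) (N : nat) (x y : X) : is_cone K ->
  sublinear_on K A -> 0 <= eta -> K x -> cone_le K x y ->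
  truncated_lyapunov K A eta N x <= truncated_lyapunov K A eta N y.
Proof.
move=> hK hA e0 Kx xy; apply: ler_sum => n _.
apply: ler_wpM2l; first exact: exprn_ge0.
apply: monotone_norm_mono => //; apply: (sublinear_mono (sublinear_iter n hK hA)) => //.
exact: cone_le_in xy.
Qed.

Lemma truncated_lyapunovD (R : realType) (X : normedModType R) (K : set X)
    (A : X -> X) (eta : R) (N : nat) (x y : X) : is_cone K ->
  sublinear_on K A -> 0 <= eta -> K x -> K y ->
  truncated_lyapunov K A eta N (x + y) <=
    truncated_lyapunov K A eta N x + truncated_lyapunov K A eta N y.
Proof.
move=> hK hA e0 Kx Ky; rewrite -big_split /=; apply: ler_sum => n _.
rewrite -mulrDr; apply: ler_wpM2l; first exact: exprn_ge0.
have hAn := sublinear_iter n hK hA.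
apply: le_trans (monotone_normD _ _ hK); apply: monotone_norm_mono => //.
exact: (sublinear_sub hAn).
Qed.

Lemma truncated_lyapunov_le (R : realType) (X : normedModType R) (K : set X)
    (A : X -> X) (eta C : R) (N : nat) (x : X) : is_cone K ->
  sublinear_on K A -> 0 <= eta -> 0 <= C ->
  (forall y, K y -> `|A y| <= C * `|y|) -> K x ->
  truncated_lyapunov K A eta N x <= (\sum_(0 <= n < N) (eta * C) ^+ n) * `|x|.
Proof.
move=> hK hA e0 C0 cP Kx; rewrite mulr_suml; apply: ler_sum => n _.
rewrite exprMn -mulrA; apply: ler_wpM2l; first exact: exprn_ge0.
apply: le_trans (monotone_norm_le (cone_lexx _ hK)) _.
have KA := sublinear_in (sublinear_iter _ hK hA).
elim: n => [|n IH]; first by rewrite expr0 mul1r.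
rewrite iterS exprS -mulrA; apply: le_trans (cP _ (KA _ _ Kx)) _.
exact: ler_wpM2l.
Qed.

Lemma truncated_lyapunov_ge (R : realType) (X : normedModType R) (K : set X)
    (A : X -> X) (eta : R) (N : nat) (x : X) : is_cone K -> 0 <= eta ->
  monotone_norm K x <= truncated_lyapunov K A eta N.+1 x.
Proof.
move=> hK e0; rewrite /truncated_lyapunov big_nat_recl//= expr0 mul1r lerDl.
apply: sumr_ge0 => n _; rewrite mulr_ge0 ?exprn_ge0//.
exact: monotone_norm_ge.
Qed.

(* eta V(A x) and V(x) differ by the boundary terms of the telescoping sum. *)
Lemma truncated_lyapunov_decrease (R : realType) (X : normedModType R)
    (K : set X) (A : X -> X) (eta : R) (N : nat) (x : X) : is_cone K ->
  sublinear_on K A -> 0 < eta ->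
  (forall y, K y -> `|iter N A y| <= eta ^- N * `|y|) -> K x ->
  truncated_lyapunov K A eta N (A x) <= eta^-1 * truncated_lyapunov K A eta N x.
Proof.
move=> hK hA e0 cP Kx; rewrite mulrC ler_pdivlMr// mulrC mulr_sumr.
under eq_bigr do rewrite mulrA -exprS -iterSr.
(* The same sum is split at its first and at its last term; comparing the two leaves
   [eta ^+ N * p(A^N x) <= p(x)], with [p] the monotone norm. *)
have : \sum_(0 <= n < N.+1) eta ^+ n * monotone_norm K (iter n A x) =
    monotone_norm K x +
    \sum_(0 <= n < N) eta ^+ n.+1 * monotone_norm K (iter n.+1 A x).
  by rewrite big_nat_recl//= expr0 mul1r.
rewrite big_nat_recr//= => E.
rewrite -(lerD2l (monotone_norm K x)) -E addrC lerD2r.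
rewrite -ler_pdivlMl ?exprn_gt0//; apply: monotone_norm_sublinear => //.
  exact: sublinear_iter.
by rewrite invr_gt0 exprn_gt0.
Qed.

Lemma ell_infty_le (R : realType) (X : normedModType R) (K : set X)
    (u : nat -> X) (k : nat) : ell_infty K u -> `|u k| <= fine (sup_norm u).
Proof.
rewrite /ell_infty /= => -[_]; set s := sup_norm u => soo.
have us : (`|u k|%:E <= s)%E by apply: ereal_sup_ubound; exists k.
by move: soo us; case: s => [r _||]; rewrite ?lee_fin.
Qed.

Lemma eISS_Lyapunov_of_iter_contraction (R : realType)
    (X : completeNormedModType R) (K : set X) (A : X -> X) (C c : R) (N : nat) :
  is_cone K -> generating K -> normal_cone K -> sublinear_on K A -> 0 <= C ->
  (forall x, K x -> `|A x| <= C * `|x|) -> 0 < c < 1 ->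
  (forall x, K x -> `|iter N.+1 A x| <= c ^+ N.+1 * `|x|) ->
  exists V : X -> R, eISS_Lyapunov K A V.
Proof.
move=> hK hgen [d d0 hd] hA C0 hC /andP[c0 c1] hc.
have e0 : 0 < c^-1 by rewrite invr_gt0.
have e0' := ltW e0.
pose V := truncated_lyapunov K A c^-1 N.+1; exists V.
(* [L] serves as the upper constant and as the gain [psi]; multiplied by the majorant constant [k]
   it is the Lipschitz constant. *)
pose L := \sum_(0 <= n < N.+1) (c^-1 * C) ^+ n.
have L0 : 0 < L.
  rewrite /L big_nat_recl//= expr0 ltr_wpDr// sumr_ge0// => n _.
  by rewrite exprn_ge0// mulr_ge0.
have VL x : K x -> V x <= L * `|x| by exact: truncated_lyapunov_le.
(* The term [n = 0] of the sum is the monotone norm, which normality bounds below by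
   [d^-1 * |x|]. *)
have dV x : K x -> d^-1 * `|x| <= V x.
  move=> Kx; apply: le_trans (truncated_lyapunov_ge _ _ _ hK e0').
  apply: monotone_norm_ge => // y xy; rewrite mulrC ler_pdivrMr// mulrC.
  by apply: hd => //; rewrite /cone_le subr0.
split.
- by move=> x Kx; apply: le_trans (dV _ Kx); rewrite mulr_ge0// invr_ge0 ltW.
- have [k k0 kP] := generating_majorant hK hgen.
  (* From [x <= y + p] follows [V x <= V y + V p], and [V p] is at most [L * |p|]. *)
  have VB x y : K x -> K y -> V x - V y <= L * k * `|x - y|.
    move=> Kx Ky; have [p [Kp xyp pk]] := kP x y.
    rewrite lerBlDl; apply: le_trans (truncated_lyapunov_mono _ hK hA e0' Kx xyp) _.
    apply: le_trans (truncated_lyapunovD _ hK hA e0' Ky Kp) _.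
    rewrite lerD2l; apply: le_trans (VL _ Kp) _.
    by rewrite -mulrA; apply: ler_wpM2l => //; exact: ltW.
  apply: (cone_lipschitz (k := L * k)) => // x y Kx Ky.
  by rewrite ler_norml VB// andbT lerNl opprB distrC VB.
exists d^-1, L, L, c^-1; split.
- by split => //; rewrite ?invr_gt0// invf_gt1.
- by move=> x Kx; rewrite dV// VL.
move=> u x hu [Kx xP] k.
have Ku : K (u k) by case: hu.
have KAx := sublinear_in hA (Kx k).
apply: le_trans (truncated_lyapunov_mono _ hK hA e0' (Kx _) (xP k)) _.
apply: le_trans (truncated_lyapunovD _ hK hA e0' KAx Ku) _.
apply: lerD; last first.
  by apply: le_trans (VL _ Ku) _; rewrite ler_pM2l//; exact: ell_infty_le hu.
apply: truncated_lyapunov_decrease => // y Ky.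
by rewrite -exprVn invrK; exact: hc.
Qed.

(** * From a Lyapunov function to eISS *)

Lemma class_Kinfty_linear (R : realType) (g : R) :
  0 < g -> class_Kinfty (fun s : R => g * s).
Proof.
move=> g0; split.
- by rewrite mulr0.
- by move=> s t _ st; rewrite ltr_pM2l.
- by apply: continuous_subspaceT => s; exact: mulrl_continuous.
- move=> c; exists ((`|c| + 1) / g); first by rewrite divr_ge0 ?addr_ge0// ltW.
  by rewrite mulrCA mulfV ?gt_eqF// mulr1; have := ler_norm c; lra.
Qed.

Lemma eISS_of_eISS_Lyapunov (R : realType) (X : normedModType R) (K : set X)
    (A : X -> X) (V : X -> R) : eISS_Lyapunov K A V -> eISS K A.
Proof.
case=> V0 _ [L1 [L2 [psi [eta [[L10 L20 psi0 eta1] VL VP]]]]].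
have a0 : 0 < eta^-1 by rewrite invr_gt0; lra.
have a1 : eta^-1 < 1 by rewrite invf_lt1//; lra.
set a := eta^-1 in a0 a1 VP.
have b0 : 0 < 1 - a by rewrite subr_gt0.
(* [L2 / L1] comes from the two-sided bound on [V]; the maximum secures [1 <= M]. *)
exists (Num.max 1 (L2 / L1)), a, (fun s => psi / (1 - a) / L1 * s); split.
- by rewrite le_max lexx.
- by rewrite a0.
- by apply: class_Kinfty_linear; rewrite !divr_gt0.
move=> u x hu hx k; have Kx := hx.1.
set s := fine (sup_norm u).
have s0 : 0 <= s by apply: le_trans (ell_infty_le 0%N hu).
(* [psi / (1 - a)] sums the geometric series of past inputs: it is the fixed point of
   [t -> a * t + psi]. *)
have Vk : V (x k) <= a ^+ k * V (x 0%N) + psi / (1 - a) * s.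
  elim: k => [|k IH].
    by rewrite expr0 mul1r lerDl mulr_ge0// divr_ge0// ltW.
  apply: le_trans (VP u x hu hx k) _; rewrite -/s exprS.
  have -> : a * a ^+ k * V (x 0%N) + psi / (1 - a) * s =
      a * (a ^+ k * V (x 0%N) + psi / (1 - a) * s) + psi * s.
    by field; rewrite gt_eqF.
  by rewrite lerD2r ler_pM2l.
have /andP[Lx _] := VL _ (Kx k); have /andP[_ LV] := VL _ (Kx 0%N).
have ak : 0 <= a ^+ k by rewrite exprn_ge0// ltW.
have {}Vk : L1 * `|x k| <= a ^+ k * (L2 * `|x 0%N|) + psi / (1 - a) * s.
  apply: le_trans Lx _; apply: le_trans Vk _; rewrite lerD2r.
  exact: ler_wpM2l.
apply: (@le_trans _ _ (L2 / L1 * `|x 0%N| * a ^+ k + psi / (1 - a) / L1 * s)).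
  rewrite -(ler_pM2l L10); apply: le_trans Vk _.
  by rewrite le_eqVlt; apply/orP; left; apply/eqP; field; rewrite !gt_eqF.
by rewrite lerD2r !ler_wpM2r// le_max lexx orbT.
Qed.

(** * Growth of iterates and the spectral radius on the cone *)

Lemma sup_norm0 (R : realType) (X : normedModType R) :
  sup_norm (fun=> 0 : X) = 0%E :> \bar R.
Proof.
rewrite /sup_norm; have -> : [set `|0 : X|%:E | _ in [set: nat]] = [set 0%E].
  by apply/seteqP; split => [_ [k _ <-]|_ ->] /=; [|exists 0%N];
    rewrite ?normr0.
exact: ereal_sup1.
Qed.

(** For zero input the orbit of [A] is itself a solution, and [gamma 0 = 0] removes the gain
    term. *)
Lemma eISS_iter_le (R : realType) (X : normedModType R) (K : set X)
    (A : X -> X) : is_cone K -> (forall x, K x -> K (A x)) -> eISS K A ->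
  exists M a : R, [/\ 0 <= M, 0 < a < 1 &
    forall n x, K x -> `|iter n A x| <= M * a ^+ n * `|x|].
Proof.
move=> hK AK [M [a [gamma [M1 a01 hg H]]]].
exists M, a; split=> [||n x Kx]//; first exact: le_trans M1.
have hu : ell_infty K (fun=> 0 : X).
  by split; [move=> k; exact: cone0 hK|rewrite sup_norm0 ltry].
have := H (fun=> 0) (fun k => iter k A x) hu.
rewrite sup_norm0 /= (Kinfty0 hg) => /(_ _ n); rewrite addr0 mulrAC; apply.
split=> [k|k]; first by elim: k => //= k; exact: AK.
by rewrite addr0; exact: cone_lexx.
Qed.

Lemma sphere_root_ge0 (R : realType) (X : normedModType R) (K : set X)
    (A : X -> X) (n : nat) : 0 <= sphere_root K A n.
Proof.
rewrite /sphere_root; set S := (X in sup X).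
(* Without a genuine supremum, [sup] takes its default value 0. *)
have [[[_ [x Sx _]] Sub]|/sup_out->//] := pselect (has_sup S).
by apply: le_trans (powR_ge0 _ _) (ub_le_sup Sub _); exists x.
Qed.

Lemma sphere_root_le (R : realType) (X : normedModType R) (K : set X)
    (A : X -> X) (c : R) (n : nat) : (0 < n)%N -> 0 <= c ->
  (forall x, K x -> `|iter n A x| <= c ^+ n * `|x|) -> sphere_root K A n <= c.
Proof.
move=> n0 c0 cP; rewrite /sphere_root; set S := (X in sup X).
have [->|/set0P S0] := eqVneq S set0; first by rewrite sup0.
apply: ge_sup => // _ [x [Kx x1] <-].
have -> : c = (c ^+ n) `^ n%:R^-1.
  by rewrite -powR_mulrn// -powRrM mulfV ?pnatr_eq0 -?lt0n// powRr1.
apply: ge0_ler_powR; rewrite ?nnegrE ?invr_ge0 ?exprn_ge0//.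
by have := cP _ Kx; rewrite x1 mulr1.
Qed.

Lemma iter_le_sphere_root (R : realType) (X : normedModType R) (K : set X)
    (A : X -> X) (C : R) (n : nat) (x : X) : is_cone K -> sublinear_on K A ->
  0 <= C -> (forall x, K x -> `|A x| <= C * `|x|) -> (0 < n)%N -> K x ->
  `|iter n A x| <= sphere_root K A n ^+ n * `|x|.
Proof.
move=> hK hA C0 hC n0; have hAn := sublinear_iter n hK hA.
(* This bound makes the set of roots bounded above, so that [sup] really dominates its members. *)
have Cn y : K y -> `|iter n A y| <= C ^+ n * `|y|.
  move=> Ky; elim: n {n0 hAn} => [|n IH]; first by rewrite expr0 mul1r.
  have KA := sublinear_in (sublinear_iter n hK hA) Ky.
  rewrite iterS exprS -mulrA; apply: le_trans (hC _ KA) _.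
  exact: ler_wpM2l.
apply: sublinear_norm_le x => // x [Kx x1].
have n0' : n%:R != 0 :> R by rewrite pnatr_eq0 -lt0n.
have -> : `|iter n A x| = (`|iter n A x| `^ n%:R^-1) ^+ n.
  by rewrite -powR_mulrn ?powR_ge0// -powRrM mulVf// powRr1.
apply: lerXn2r; rewrite ?nnegrE ?powR_ge0 ?sphere_root_ge0//.
apply: ub_le_sup; last by exists x.
exists ((C ^+ n) `^ n%:R^-1) => _ [y [Ky y1] <-].
apply: ge0_ler_powR; rewrite ?nnegrE ?invr_ge0 ?exprn_ge0//.
by have := Cn _ Ky; rewrite y1 mulr1.
Qed.

(** The gap between [c] and [b] absorbs the factor [D]: since [D * (c / b) ^+ n] tends to 0,
    eventually [D * c ^+ n <= b ^+ n]. *)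
Lemma sphere_root_near_le (R : realType) (X : normedModType R) (K : set X)
    (A : X -> X) (D c b : R) : 0 <= D -> 0 <= c -> c < b ->
  (forall n x, K x -> `|iter n A x| <= D * c ^+ n * `|x|) ->
  \forall n \near \oo, sphere_root K A n <= b.
Proof.
move=> D0 c0 cb H; have b0 : 0 < b by exact: le_lt_trans cb.
have cb1 : `|c / b| < 1.
  by rewrite ger0_norm; [rewrite ltr_pdivrMr ?mul1r|exact: divr_ge0 (ltW b0)].
have geo1 := cvgr0_norm_lt _ (cvg_geometric D cb1) _ ltr01.
near=> n; apply: sphere_root_le; [by near: n; exact: nbhs_infty_gt|exact: ltW|].
move=> x Kx; apply: le_trans (H _ _ Kx) _; apply: ler_wpM2r => //.
have : `|geometric D (c / b) n| < 1 by near: n; exact: geo1.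
rewrite /= exprMn exprVn mulrA => /ltW/(le_trans (ler_norm _)).
by rewrite ler_pdivrMr ?exprn_gt0// mul1r.
Unshelve. all: by end_near. Qed.

(** Divide [n] by [m]: the full blocks of [m] steps contract by [c ^+ m] each, and the fewer than
    [m] remaining steps cost at most the fixed factor [t ^+ m]. *)
Lemma iter_geometric (R : realType) (X : normedModType R) (K : set X)
    (A : X -> X) (C c : R) (m : nat) : (0 < m)%N -> 0 < c -> 0 <= C ->
  (forall x, K x -> K (A x)) -> (forall x, K x -> `|A x| <= C * `|x|) ->
  (forall x, K x -> `|iter m A x| <= c ^+ m * `|x|) ->
  exists2 D : R, 0 <= D &
    forall n x, K x -> `|iter n A x| <= D * c ^+ n * `|x|.
Proof.
move=> m0 c0 C0 AK hC hc.
have Kiter n x : K x -> K (iter n A x) by move=> Kx; elim: n => //= n; exact: AK.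
(* Chosen so that [C <= t * c], and at least 1 so that its powers increase. *)
set t := Num.max 1 (C / c).
have t1 : 1 <= t by rewrite le_max lexx.
exists (t ^+ m) => [|n x Kx]; first by rewrite exprn_ge0// (le_trans _ t1).
have Cr y r : K y -> `|iter r A y| <= t ^+ r * c ^+ r * `|y|.
  move=> Ky; rewrite -exprMn; elim: r => [|r IH]; first by rewrite expr0 mul1r.
  rewrite iterS; apply: le_trans (hC _ (Kiter _ _ Ky)) _.
  rewrite exprS -[leRHS]mulrA; apply: ler_pM => //.
  by rewrite -ler_pdivrMr// /t le_max lexx orbT.
have cq y q : K y -> `|iter (q * m) A y| <= c ^+ (q * m) * `|y|.
  move=> Ky; elim: q => [|q IH]; first by rewrite mul0n expr0 mul1r.
  rewrite mulSn iterD exprD -mulrA; apply: le_trans (hc _ (Kiter _ _ Ky)) _.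
  by apply: ler_wpM2l => //; rewrite exprn_ge0// ltW.
have rm : (n %% m <= m)%N by rewrite ltnW// ltn_pmod.
have -> : iter n A x = iter (n %% m) A (iter (n %/ m * m) A x).
  by rewrite -iterD addnC -divn_eq.
have -> : t ^+ m * c ^+ n = t ^+ m * c ^+ (n %% m) * c ^+ (n %/ m * m).
  by rewrite -mulrA -exprD addnC -divn_eq.
apply: le_trans (Cr _ _ (Kiter _ _ Kx)) _.
rewrite -[leRHS]mulrA; apply: ler_pM => //.
- by rewrite mulr_ge0// exprn_ge0//; [exact: le_trans t1|exact: ltW].
- apply: ler_wpM2r; first by rewrite exprn_ge0// ltW.
  exact: ler_weXn2l.
- exact: cq.
Qed.

(** The limit is the infimum over positive indices: all later terms lie above it, and the hypothesis
    pushes the tail below any [c] exceeding some [s m]. *)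
Lemma cvgn_of_near_le (R : realType) (s : nat -> R) :
  (forall n, 0 <= s n) ->
  (forall m c, (0 < m)%N -> s m < c -> \forall n \near \oo, s n <= c) ->
  cvgn s.
Proof.
move=> s0 sP; pose S := [set s n | n in [set n | (0 < n)%N]].
have S0 : has_inf S by split; [exists (s 1%N), 1%N|exists 0 => _ [n _ <-]].
apply/cvg_ex; exists (inf S); apply/cvgrPdist_le => e e0.
have [_ [m m0 <-] sm] := inf_adherent e0 S0.
near=> n; rewrite ler_distl; apply/andP; split.
  by rewrite lerBlDr; near: n; exact: sP sm.
rewrite -[leLHS]addr0; apply: lerD; last exact: ltW.
apply: ge_inf; first exact: S0.2.
by exists n => //=; near: n; exact: nbhs_infty_gt.
Unshelve. all: by end_near. Qed.

(* Fekete's argument, carried out on the operator bounds instead of on the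
   submultiplicative sequence of norms. *)
Lemma cvgn_sphere_root (R : realType) (X : normedModType R) (K : set X)
    (A : X -> X) (C : R) : is_cone K -> sublinear_on K A -> 0 <= C ->
  (forall x, K x -> `|A x| <= C * `|x|) -> cvgn (sphere_root K A).
Proof.
move=> hK hA C0 hC; apply: cvgn_of_near_le => [n|m c m0 smc].
  exact: sphere_root_ge0.
(* The gap below [d] makes [d] positive even if the root is 0; the gap up to [c] absorbs the factor
   [D]. *)
have [d sd dc] : exists2 d, sphere_root K A m < d & d < c.
  by exists ((sphere_root K A m + c) / 2); lra.
have d0 : 0 < d by apply: le_lt_trans sd; exact: sphere_root_ge0.
have [|D D0 HD] := iter_geometric m0 d0 C0 (sublinear_in hA) hC.
  move=> x Kx; apply: le_trans (iter_le_sphere_root hK hA C0 hC m0 Kx) _.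
  apply: ler_wpM2r => //; apply: lerXn2r; rewrite ?nnegrE ?sphere_root_ge0//.
    exact: ltW.
  exact: ltW.
exact: (sphere_root_near_le D0 (ltW d0) dc HD).
Qed.

Theorem propositionA1 (R : realType) (X : completeNormedModType R)
  (K : set X) (A : X -> X)
  (hcone : is_cone K) (hgen : generating K) (hnormal : normal_cone K)
  (hAK : forall x : X, K x -> K (A x))
  (hmono : monotone_on K A)
  (hhom : forall (r : R) (x : X), 0 <= r -> K x -> A (r *: x) = r *: A x)
  (hsub : forall x y : X, K x -> K y -> cone_le K (A (x + y)) (A x + A y))
  (hbnd : (ereal_sup [set `|A x|%:E | x in cone_sphere K] < +oo)%E) :
  [/\ [lipschitz A x | x in K],
      cvgn (sphere_root K A) &
      [<-> eISS K A;
           cone_radius K A < 1;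
           exists V : X -> R, eISS_Lyapunov K A V]].
Proof.
have hA : sublinear_on K A by split.
have [C C1 hC] := sublinear_bounded hcone hA hbnd.
have C0 : 0 <= C by exact: le_trans C1.
have cvg_root := cvgn_sphere_root hcone hA C0 hC.
split=> //; first exact: normal_lipschitz hC.
tfae.
- move=> /(eISS_iter_le hcone hAK)[M [a [M0 /andP[a0 a1] H]]].
  (* A rate strictly between [a] and 1 leaves room to absorb [M] and still keeps the limit below
     1. *)
  have ab : a < (a + 1) / 2 by lra.
  apply: (@le_lt_trans _ _ ((a + 1) / 2)); last by lra.
  by apply: limr_le => //; exact: (sphere_root_near_le M0 (ltW a0) ab H).
- move=> r1; have /= near1 := cvgr_lt _ cvg_root _ r1.
  have [N sN] : exists N, sphere_root K A N.+1 < 1.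
    have [N _ NP] := near1.
    by exists N; apply: NP => /=; exact: leqnSn.
  have sN0 := sphere_root_ge0 K A N.+1.
  (* The midpoint with 1 is positive even when the root vanishes, so the contraction factor can be
     inverted to give [eta]. *)
  have c01 : 0 < (sphere_root K A N.+1 + 1) / 2 < 1 by apply/andP; split; lra.
  apply: (eISS_Lyapunov_of_iter_contraction (N := N) hcone hgen hnormal hA C0 hC c01).
  move=> x Kx; apply: le_trans (iter_le_sphere_root hcone hA C0 hC _ Kx) _ => //.
  apply: ler_wpM2r => //; apply: lerXn2r; rewrite ?nnegrE//; first by lra.
  by lra.
- by case=> V; exact: eISS_of_eISS_Lyapunov.
Qed.
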